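(* Let $G$ be a connected hypergraph. Then the following are equivalent: (1) $G$ is odd-bipartite. (2) $\mathcal{L}_G$ and $\mathcal{Q}_G$ have the same spectrum and H-spectrum. (3) $0$ is an H-eigenvalue of $\mathcal{Q}_G$.
   Context: A (finite) hypergraph $H$ has vertex set $V(H)$ and edge set $E(H)$, a set of nonempty subsets of $V(H)$, with at least one edge (so that the rank is defined). The degree of a vertex is the number of edges containing it. The rank $r(H)$ is the maximum cardinality of an edge. A path of length $l$ is an alternating sequence $u_1e_1u_2\cdots u_le_lu_{l+1}$ with distinct vertices $u_1,\ldots,u_{l+1}$ and distinct edges $e_1,\ldots,e_l$ such that $u_i,u_{i+1}\in e_i$ for all $i$; $H$ is connected if there is a path between any two vertices. $H$ is odd-bipartite if its vertex set has a partition $V(H)=V_1\cup V_2$ such that each edge of $H$ contains an odd number of vertices in $V_1$ and an odd number of vertices in $V_2$. The adjacency tensor $\mathcal{A}_H=(a_{i_1\cdots i_k})$ of a hypergraph $H$ with $r(H)=k$ is the order $k$, dimension $|V(H)|$ symmetric tensor with $a_{i_1\cdots i_k}=\frac{1}{(k-1)!}$ if $\{i_1,\ldots,i_k\}$ is an edge of cardinality $k$; $a_{i_1\cdots i_k}=\frac{(k-s+1)!}{k!}$ if, as a multiset, $\{i_1,\ldots,i_k\}$ consists of $j_1$ with multiplicity $k-s+1$ and $j_2,\ldots,j_s$ each with multiplicity one, for some edge $\{j_1,\ldots,j_s\}\in E(H)$ of cardinality $s<k$ (any element of the edge may play the role of $j_1$); and $a_{i_1\cdots i_k}=0$ otherwise.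 $\mathcal{D}_H$ is the order $k$ dimension $|V(H)|$ diagonal tensor whose diagonal entries are the vertex degrees; $\mathcal{L}_H=\mathcal{D}_H-\mathcal{A}_H$ is the Laplacian tensor and $\mathcal{Q}_H=\mathcal{D}_H+\mathcal{A}_H$ is the signless Laplacian tensor. For an order $m$ dimension $n$ tensor $\mathcal{A}=(a_{i_1\cdots i_m})$ and $x\in\mathbb{C}^n$, $\mathcal{A}x^{m-1}\in\mathbb{C}^n$ has $i$-th component $\sum_{i_2,\ldots,i_m=1}^n a_{ii_2\cdots i_m}x_{i_2}\cdots x_{i_m}$. A number $\lambda\in\mathbb{C}$ is an eigenvalue of $\mathcal{A}$ with eigenvector $x$ if $x\in\mathbb{C}^n$ is nonzero and $\mathcal{A}x^{m-1}=\lambda x^{[m-1]}$, where $x^{[m-1]}=(x_1^{m-1},\ldots,x_n^{m-1})^{\mathrm T}$. A real eigenvalue having a real eigenvector is an H-eigenvalue. The spectrum of $\mathcal{A}$ is the set of all its eigenvalues, and the H-spectrum is the set of all its H-eigenvalues. *)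

(* Defs.v *)
From HB Require Import structures.
From mathcomp Require Import all_boot all_order all_algebra.
From mathcomp Require Import complex.
From mathcomp Require Import boolp classical_sets reals.

Set Implicit Arguments.
Unset Strict Implicit.
Unset Printing Implicit Defensive.

Import Order.TTheory GRing.Theory Num.Theory.
Local Open Scope ring_scope.

(* The vertex set is the whole finite type V. *)
Record hypergraph (V : finType) := Hypergraph {
  edges : {set {set V}};
  edges_nonempty : finset.set0 \notin edges;
  edges_exist : edges != finset.set0 }.

Section Hypergraph.
Variables (V : finType) (H : hypergraph V).

Definition degree (v : V) : nat := #|[set e in edges H | v \in e]|.

Definition rank : nat := \max_(e in edges H) #|e|.

(* The path w_0 e_0 w_1 ... e_(l-1) w_l; length 0 only joins a vertex to
   itself. *)
Definition joined_by_path (u v : V) : Prop :=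
  exists (l : nat) (w : 'I_l.+1 -> V) (e : 'I_l -> {set V}),
    [/\ injective w, injective e, w ord0 = u, w ord_max = v &
        forall i : 'I_l,
          [/\ e i \in edges H, w (widen_ord (leqnSn l) i) \in e i &
              w (lift ord0 i) \in e i]].

Definition connected_hypergraph : Prop := forall u v : V, joined_by_path u v.

(* Both parts are automatically nonempty, since H has an edge. *)
Definition odd_bipartite : Prop :=
  exists V1 V2 : {set V},
    [/\ V1 :|: V2 = [set: V], V1 :&: V2 = finset.set0 &
        forall e, e \in edges H -> odd #|e :&: V1| /\ odd #|e :&: V2|].

End Hypergraph.

(* Tensors of order m with indices in V; the dimension is #|V|. *)
Notation tensor C V m := {ffun m.-tuple V -> C}.

Section Tensor.
Variables (C : numClosedFieldType) (V : finType) (m : nat).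
Implicit Types (A : tensor C V m) (x : {ffun V -> C}).

(* The vector A x^(m-1): its i-th component is the sum over the index tuples
   t = (i, i_2, ..., i_m), so that behead t = (i_2, ..., i_m). *)
Definition tensor_apply A x : {ffun V -> C} :=
  [ffun i => \sum_(t : m.-tuple V | ohead t == Some i)
               A t * \prod_(v <- behead t) x v].

Definition power_vector x (p : nat) : {ffun V -> C} := [ffun i => x i ^+ p].

Definition eigenpair A (lambda : C) x : Prop :=
  x != 0 /\ tensor_apply A x = [ffun i => lambda * power_vector x m.-1 i].

Definition eigenvalue A (lambda : C) : Prop := exists x, eigenpair A lambda x.

Definition H_eigenvalue A (lambda : C) : Prop :=
  lambda \is Num.real /\
  exists x, (forall v, x v \is Num.real) /\ eigenpair A lambda x.

Definition spectrum A : set C := [set lambda | eigenvalue A lambda]%classic.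

Definition H_spectrum A : set C := [set lambda | H_eigenvalue A lambda]%classic.

Definition diagonal_tensor (d : V -> C) : tensor C V m :=
  [ffun t : m.-tuple V =>
    (if [pick v | t == nseq_tuple m v] is Some v then d v else 0) : C].

End Tensor.

Section HypergraphTensors.
Variables (C : numClosedFieldType) (V : finType) (H : hypergraph V).

(* The only edge that can contribute to the entry at t is the support of t.
   When it has s < k elements, the entry is nonzero iff t is, up to order, some
   vertex j of the edge repeated k - s + 1 times followed by the other ones. *)
Definition adjacency_tensor : tensor C V (rank H) :=
  [ffun t : (rank H).-tuple V =>
    let k := rank H in
    let e := [set v in t] in
    let s := #|e| in
    if e \notin edges H then 0
    else if s == k then (k.-1)`!%:R^-1
    else if [exists j in e,
               perm_eq t (nseq (k - s).+1 j ++ enum (e :\ j))]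
    then (k - s).+1`!%:R / k`!%:R
    else 0].

Definition degree_tensor : tensor C V (rank H) :=
  diagonal_tensor (rank H) (fun v => (degree H v)%:R : C).

Definition laplacian_tensor : tensor C V (rank H) :=
  degree_tensor - adjacency_tensor.

Definition signless_laplacian_tensor : tensor C V (rank H) :=
  degree_tensor + adjacency_tensor.

End HypergraphTensors.

(* Main.v *)
Require Import Defs.
From HB Require Import structures.
From mathcomp Require Import all_boot all_order all_algebra.
From mathcomp Require Import complex.
From mathcomp Require Import boolp classical_sets reals.

Set Implicit Arguments.
Unset Strict Implicit.
Unset Printing Implicit Defensive.

Import Order.TTheory GRing.Theory Num.Theory.

Local Open Scope ring_scope.
Local Open Scope complex_scope.

(** Write [k] for the rank. The adjacency tensor is best read as a sum over
pointed edges: an edge [e] of size [s] with a distinguished vertex [j] in [e]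
contributes [(k - s + 1)! / k!] to every index tuple that is a rearrangement of
the word consisting of [k - s + 1] copies of [j] and one copy of each other
vertex of [e] ([adjacency_tensorE]). When [s = k] all the [j] in [e] give the
same rearrangements and the [k] contributions add up to [1 / (k - 1)!]; when
[s < k] the repeated letter [j] can be recovered from the tuple. The entries are
therefore nonnegative, and counting the rearrangements that start with a given
vertex [i] shows that the entries of row [i] add up to the degree of [i]
([adjacency_tensor_row_sum]).

From odd-bipartite to equal spectra: let [sgn] be [-1] on one part and [1] on
the other. Every edge is even and has an odd number of vertices in the part of
sign [-1], so [k] is even and the product of [sgn] along any tuple with nonzero
adjacency entry is [-1]. Hence [x |-> sgn * x], an involution that preserves
real vectors, exchanges the eigenvectors of the Laplacian and of the signless
Laplacian, with the same eigenvalue ([spectra_eq_of_odd_bipartite]).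

From equal spectra to the eigenvalue [0]: by the row sums the all-ones vector is
in the kernel of the Laplacian ([H_eigenvalue_laplacian0]).

From the eigenvalue [0] to odd-bipartite: let [x] be a nonzero real kernel
vector of the signless Laplacian and [i] a vertex where [|x i|] is largest.
The equation at [i] says that a weighted sum of monomials, with positive weights
of total [degree i], equals [- degree i * x i ^ (k - 1)], while each monomial is
at most [|x i| ^ (k - 1)] in absolute value. So each monomial equals
[- x i ^ (k - 1)]. The monomial of the edge [e] pointed at [i] itself already
gives [x i ^ (k - s) * prod_(v in e) x v = - x i ^ k]
([signless_kernel_at_max]). Taking absolute values, [|x|] is constant on [e],
hence on the whole hypergraph by connectedness. The equation then only speaks of
signs: with [N] the set of vertices where [x] is negative, it reads
[(-1) ^ |e :&: N| = - sgn(x i) ^ s] for all [i] in [e]. If [s] were odd, [x]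
would have constant sign on [e] and this would fail; so [s] is even and
[|e :&: N|] is odd, i.e. [N] and its complement form an odd bipartition. *)

(** * Counting rearrangements of a word with one repeated letter *)

(** Deleting the first letter of a rearrangement gives the Pascal-like recursion
that [(m + n)! / m!] satisfies: the first letter is either [j], which lowers
[m], or one of the [n] letters of [s], which lowers [n]. *)
Lemma size_permutations_nseq_cat (T : eqType) (m : nat) (j : T) (s : seq T) :
  uniq s -> j \notin s ->
  (size (permutations (nseq m j ++ s)) * m`! = (m + size s)`!)%N.
Proof.
elim: m s => [|m IHm] s s_uniq; first by rewrite muln1 size_permutations.
have [n] := ubnP (size s); elim: n s s_uniq => // n IHn s s_uniq ltsn js.
have undupE : perm_eq (undup (nseq m.+1 j ++ s)) (j :: s).
  apply: uniq_perm; rewrite ?undup_uniq ?cons_uniq ?js // => x.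
  by rewrite mem_undup mem_cat mem_nseq inE.
rewrite (perm_size (permutationsE _)) // size_allpairs_dep sumnE big_map.
rewrite (perm_big _ undupE) big_cons mulnDl [rem j _]/= eqxx.
rewrite factS mulnCA IHm // big_seq big_distrl /=.
rewrite (eq_bigr (fun=> (m + size s)`!)) => [|x xs]; last first.
  have remE : perm_eq (rem x (nseq m.+1 j ++ s)) (nseq m.+1 j ++ rem x s).
    rewrite -(perm_cons x) -(permPl (perm_to_rem _)) ?mem_cat ?xs ?orbT //.
    rewrite perm_sym -cat1s perm_catCA perm_cat2l perm_sym.
    exact: perm_to_rem.
  rewrite -factS (perm_size (perm_permutations remE)) IHn ?rem_uniq //.
  - by rewrite size_rem // addSnnS prednK //; case: (s) xs.
  - by rewrite size_rem //; case: (s) xs ltsn.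
  - by apply: contra js => /mem_rem.
rewrite -big_seq big_const_seq count_predT iter_addn_0 addSn factS.
by rewrite [(_ * size s)%N]mulnC -mulnDl addSn.
Qed.

Lemma card_tuple_head_perm (V : finType) (k : nat) (i : V) (s : seq V) :
  i \in s -> size s = k ->
  #|[set t : k.-tuple V | (ohead t == Some i) && perm_eq t s]| =
    size (permutations (rem i s)).
Proof.
move=> is_ sk; rewrite cardE -(size_map val).
rewrite -(size_map (cons i) (permutations _)); apply: perm_size.
apply: uniq_perm.
- by rewrite (map_inj_uniq val_inj) enum_uniq.
- by rewrite map_inj_uniq ?permutations_uniq // => ? ? [].
move=> u; apply/mapP/mapP => [[t]|[r]].
  rewrite mem_enum inE => /andP[hd st] ->.
  case: t hd st => -[|a r] //= _ /eqP[->] st.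
  exists r => //; rewrite mem_permutations -(perm_cons i).
  by rewrite (perm_trans st) // perm_to_rem.
rewrite mem_permutations => rs ->.
have irs : perm_eq (i :: r) s.
  by rewrite perm_sym (perm_trans (perm_to_rem is_)) // perm_cons perm_sym.
have sz : size (i :: r) == k by rewrite (perm_size irs) sk.
by exists (Tuple sz); rewrite ?mem_enum ?inE /= ?eqxx.
Qed.

(** The word of the pointed edge [(e, j)]; [r] is the number of surplus copies of
[j], so that the word has length [r + #|e|]. *)
Definition edge_word (V : finType) (r : nat) (e : {set V}) (j : V) : seq V :=
  nseq r.+1 j ++ enum (e :\ j).

Section EdgeWord.
Variables (V : finType) (e : {set V}).

Lemma size_edge_word r j : j \in e -> size (edge_word r e j) = (r + #|e|)%N.
Proof.
by move=> je; rewrite size_cat size_nseq -cardE [in RHS](cardsD1 j) je addnS.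
Qed.

Lemma mem_edge_word r j : j \in e -> edge_word r e j =i e.
Proof.
move=> je v; rewrite mem_cat mem_nseq mem_enum !inE.
by case: eqVneq => //= ->.
Qed.

Lemma count_edge_word r i j :
  count_mem i (edge_word r e j) = ((j == i) * r.+1 + (i \in e :\ j))%N.
Proof.
by rewrite count_cat count_nseq count_uniq_mem ?enum_uniq // mem_enum.
Qed.

Lemma prod_edge_word (R : comPzRingType) (F : V -> R) r j : j \in e ->
  \prod_(v <- edge_word r e j) F v = F j ^+ r * \prod_(v in e) F v.
Proof.
move=> je; rewrite big_cat big_nseq iter_mulr_1 big_enum (bigD1 j je) /=.
rewrite exprSr -mulrA; congr (_ * (_ * _)).
by apply: eq_bigl => v; rewrite !inE andbC.
Qed.

(** Removing the repeated letter leaves [r] copies of it, removing any other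
letter leaves [r + 1] copies; hence the extra factor when [j = i]. *)
Lemma size_permutations_rem_edge_word r i j : i \in e -> j \in e ->
  (size (permutations (rem i (edge_word r e j))) * r.+1`! =
     (r + #|e|).-1`! * (if j == i then r.+1 else 1))%N.
Proof.
move=> ie je; have := cardsD1 j e; rewrite je add1n => ->; rewrite addnS succnK.
have [->|ji] := eqVneq j i.
  rewrite /edge_word [rem i _]/= eqxx factS mulnCA size_permutations_nseq_cat.
  - by rewrite -cardE mulnC.
  - exact: enum_uniq.
  - by rewrite mem_enum !inE eqxx.
have iej : i \in e :\ j by rewrite !inE eq_sym ji.
have remE : perm_eq (rem i (edge_word r e j))
    (nseq r.+1 j ++ enum (e :\ j :\ i)).
  rewrite -(perm_cons i) -(permPl (perm_to_rem _)) ?mem_edge_word //.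
  rewrite perm_sym -cat1s perm_catCA perm_cat2l /=.
  apply: uniq_perm; rewrite ?cons_uniq ?enum_uniq ?mem_enum ?inE ?eqxx //.
  move=> v; rewrite inE !mem_enum !inE.
  by case: eqVneq => // ->; rewrite eq_sym ji.
rewrite (perm_size (perm_permutations remE)) size_permutations_nseq_cat.
- by rewrite -cardE muln1 [in RHS](cardsD1 i) iej addnS addSn.
- exact: enum_uniq.
- by rewrite mem_enum !inE eqxx andbF.
Qed.

(** Why each edge through [i] contributes exactly [1] to the row sum at [i]:
the weights are proportional to [r + 1] for [j = i] and to [1] for each of the
[#|e| - 1] other vertices, and these add up to [r + #|e|]. *)
Lemma sum_permutations_rem_edge_word r i : i \in e ->
  ((\sum_(j in e) size (permutations (rem i (edge_word r e j)))) * r.+1`! =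
     (r + #|e|)`!)%N.
Proof.
move=> ie; rewrite big_distrl /=.
under eq_bigr => j je do rewrite size_permutations_rem_edge_word //.
rewrite -big_distrr (bigD1 i ie) /= eqxx.
under eq_bigr => j /andP[_ /negPf ->] do [].
rewrite sum1dep_card.
have -> : #|[set j in e | j != i]%SET| = #|e :\ i|.
  by apply: eq_card => j; rewrite !inE andbC.
by have := cardsD1 i e; rewrite ie add1n => ->; rewrite addnS addSn factS mulnC.
Qed.

End EdgeWord.

(** * Applying a tensor to a vector *)

Section TensorApply.
Variables (C : numClosedFieldType) (V : finType) (m : nat).
Implicit Types (A B : tensor C V m) (x : {ffun V -> C}).

Lemma tensor_applyD A B x :
  tensor_apply (A + B) x = tensor_apply A x + tensor_apply B x.
Proof.
apply/ffunP => i; rewrite !ffunE -big_split; apply: eq_bigr => t _.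
by rewrite ffunE mulrDl.
Qed.

Lemma tensor_applyN A x : tensor_apply (- A) x = - tensor_apply A x.
Proof.
apply/ffunP => i; rewrite !ffunE -sumrN; apply: eq_bigr => t _.
by rewrite ffunE mulNr.
Qed.

Lemma tensor_apply_diagonal (d : V -> C) x i : (0 < m)%N ->
  tensor_apply (diagonal_tensor m d) x i = d i * x i ^+ m.-1.
Proof.
move=> m_gt0; rewrite ffunE.
have nseq_inj (v w : V) : nseq_tuple m v = nseq_tuple m w -> v = w.
  by move/(congr1 val); case: (m) m_gt0 => // n _ [].
rewrite (bigD1 (nseq_tuple m i)) /=; last by case: (m) m_gt0 => //= n _.
rewrite ffunE; case: pickP => [v /= /eqP /nseq_inj <-|/(_ i)]; last first.
  by rewrite eqxx.
rewrite [X in _ + X]big1 ?addr0 => [|t /andP[/eqP hd t_neq]].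
  by case: (m) m_gt0 => // n _; rewrite /= big_nseq iter_mulr_1.
rewrite ffunE; case: pickP => [w /= /eqP t_eq|_]; last by rewrite mul0r.
case/eqP: t_neq; rewrite t_eq; congr nseq_tuple.
by move: hd; rewrite t_eq; case: (m) m_gt0 => //= n _ [].
Qed.

End TensorApply.

(** * The adjacency tensor as a sum over pointed edges *)

Section Adjacency.
Variables (C : numClosedFieldType) (V : finType) (G : hypergraph V).
Implicit Types (x : {ffun V -> C}) (e : {set V}) (t : (rank G).-tuple V).

Local Notation k := (rank G).
Local Notation adj := (adjacency_tensor C G).
Local Notation gap e := (rank G - #|e|)%N.

Lemma card_edge_le_rank e : e \in edges G -> (#|e| <= k)%N.
Proof. by move=> eG; rewrite /rank (bigD1 e eG) leq_maxl. Qed.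

Lemma card_edge_gt0 e : e \in edges G -> (0 < #|e|)%N.
Proof.
move=> eG; rewrite card_gt0; apply: contraTneq eG => ->.
exact: edges_nonempty.
Qed.

Lemma edge_of_max_card : exists2 e, e \in edges G & #|e| = k.
Proof.
have: (0 < #|edges G|)%N by rewrite card_gt0 edges_exist.
case/(eq_bigmax_cond (fun e : {set V} => #|e|)) => e eG e_max.
by exists e; rewrite // /rank e_max.
Qed.

Lemma rank_gt0 : (0 < k)%N.
Proof. by have [e eG <-] := edge_of_max_card; exact: card_edge_gt0. Qed.

(** The two nonzero cases of the definition merge: a tuple supported on an edge
of maximal size arises from all [k] pointings of that edge, any other tuple from
at most one pointing. *)
Lemma adjacency_tensorE t :
  adj t = \sum_(e in edges G) \sum_(j in e | perm_eq t (edge_word (gap e) e j))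
            (gap e).+1`!%:R / k`!%:R.
Proof.
have supp e j : j \in e -> perm_eq t (edge_word (gap e) e j) ->
    [set v in t]%SET = e.
  move=> je /perm_mem te; apply/setP => v.
  by rewrite inE te mem_edge_word.
rewrite ffunE /=; case: ifPn => [eG|/negbNE eG].
  rewrite big1 // => e eE; rewrite big1 // => j /andP[je /(supp _ _ je) te].
  by rewrite te eE in eG.
rewrite (bigD1 [set v in t]%SET) //= [X in _ = _ + X]big1 ?addr0; last first.
  move=> e /andP[_ e_neq]; rewrite big1 // => j /andP[je /(supp _ _ je) te].
  by rewrite te eqxx in e_neq.
set e := [set v in t]%SET.
have [ek|ek] := eqVneq #|e| k.
  rewrite ek subnn mul1r.
  have t_uniq : uniq t.
    apply/card_uniqP; rewrite size_tuple -[RHS]ek.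
    by apply: eq_card => v; rewrite inE.
  rewrite (eq_bigl (fun j => j \in e)) => [|j].
    rewrite sumr_const ek -[RHS]mulr_natl; have := rank_gt0; case: (k) => // n _.
    rewrite factS natrM invfM mulrA divff ?mul1r //.
    by rewrite pnatr_eq0.
  case: (boolP (j \in e)) => //= je; apply: uniq_perm => // [|v].
    by rewrite cons_uniq mem_enum !inE eqxx enum_uniq.
  by rewrite (mem_edge_word 0 je) inE.
case: ifPn => [/existsP[j /andP[je tj]]|/existsPn no_j]; last first.
  by rewrite big1 // => j jt; have := no_j j; rewrite jt.
(* As [#|e| < k], the letter [j] is the only one that occurs more than once. *)
rewrite (bigD1 j) /=; last by rewrite je.
rewrite big1 ?addr0 // => i /andP[/andP[ie ti] ij].
have gap_gt0 : (0 < gap e)%N.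
  by rewrite subn_gt0 ltn_neqAle ek card_edge_le_rank.
have := permP tj (pred1 i); rewrite (permP ti) -/(edge_word (gap e) e j).
rewrite !count_edge_word !in_setD1 !eqxx (eq_sym j i) ij (negPf ij) ie.
rewrite /= mul1n addn0.
by case: (gap e) gap_gt0.
Qed.

Lemma adjacency_tensor_ge0 t : 0 <= adj t.
Proof.
rewrite adjacency_tensorE; do 2 apply: sumr_ge0 => ? _.
by rewrite divr_ge0.
Qed.

Lemma adjacency_tensor_gt0 e j t : e \in edges G -> j \in e ->
  perm_eq t (edge_word (gap e) e j) -> 0 < adj t.
Proof.
move=> eG je tj; rewrite adjacency_tensorE (bigD1 e eG) /=.
rewrite (bigD1 j) /= ?je // -addrA ltr_wpDr //.
  by rewrite addr_ge0 //; do 2?[apply: sumr_ge0 => ? _]; rewrite divr_ge0.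
by rewrite divr_gt0 // ltr0n fact_gt0.
Qed.

Lemma adjacency_tensor_neq0P t : adj t != 0 ->
  exists e j, [/\ e \in edges G, j \in e & perm_eq t (edge_word (gap e) e j)].
Proof.
rewrite adjacency_tensorE => nz.
have [e eG nze] : exists2 e, e \in edges G &
    \sum_(j in e | perm_eq t (edge_word (gap e) e j))
            (gap e).+1`!%:R / k`!%:R != 0 :> C.
  apply/exists_inP; apply: contraNT nz => /exists_inPn no_e.
  by rewrite big1 // => e eG; apply/eqP/negbNE/no_e.
have [j je] : exists j, (j \in e) && perm_eq t (edge_word (gap e) e j).
  apply/existsP; apply: contraNT nze => /existsPn no_j.
  by rewrite big1 // => j jt; have := no_j j; rewrite jt.
by exists e, j; case/andP: je.
Qed.

Lemma adjacency_tensor_row_sum i :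
  \sum_(t : k.-tuple V | ohead t == Some i) adj t = (degree G i)%:R.
Proof.
under eq_bigr => t _ do rewrite adjacency_tensorE.
rewrite exchange_big /= (bigID (fun e => i \in e)) /= addrC big1 ?add0r.
  rewrite /degree -sum1dep_card natr_sum; apply: eq_bigr => e /andP[eG ie].
  rewrite (exchange_big_dep (fun j => j \in e)) /=; last by move=> t j _ /andP[].
  have gapK : (gap e + #|e|)%N = k by rewrite subnK // card_edge_le_rank.
  pose arrangements j := permutations (rem i (edge_word (gap e) e j)).
  rewrite (eq_bigr (fun j =>
      (size (arrangements j))%:R * ((gap e).+1`!%:R / k`!%:R))).
    rewrite -mulr_suml -natr_sum mulrA -natrM.
    rewrite sum_permutations_rem_edge_word //.
    by rewrite gapK divff // pnatr_eq0 -lt0n fact_gt0.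
  move=> j je; rewrite sumr_const -[LHS]mulr_natl; congr (_%:R * _).
  rewrite -(@card_tuple_head_perm _ k) ?mem_edge_word ?size_edge_word //.
  by apply: eq_card => t; rewrite !inE je.
move=> e /andP[eG ie]; rewrite big1 // => t /eqP hd.
rewrite big1 // => j /andP[je tj].
case/negP: ie; rewrite -(mem_edge_word (gap e) je) -(perm_mem tj).
by case: t hd tj => -[|a r] //= _ [->] _; rewrite inE eqxx.
Qed.

Lemma apply_degree_tensor x i :
  tensor_apply (degree_tensor C G) x i = (degree G i)%:R * x i ^+ k.-1.
Proof. exact/tensor_apply_diagonal/rank_gt0. Qed.

End Adjacency.

(** * Switching signs along an odd bipartition *)

Lemma prod_sign (R : comPzRingType) (V : finType) (A N : {set V}) :
  \prod_(v in A) (-1) ^+ (v \in N) = (-1) ^+ #|A :&: N| :> R.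
Proof.
rewrite (bigID (mem N)) /= [X in _ * X]big1 ?mulr1; last first.
  by move=> v /andP[_ /negPf ->].
rewrite -prodr_const; apply: eq_big => v; first by rewrite inE.
by case/andP => _ ->.
Qed.

Section Switching.
Variables (C : numClosedFieldType) (V : finType) (G : hypergraph V).
Variable N : {set V}.
Hypothesis N_odd : forall e, e \in edges G -> odd #|e :&: N|.
Hypothesis edges_even : forall e, e \in edges G -> ~~ odd #|e|.
Implicit Types (x : {ffun V -> C}).

Local Notation sgn v := ((-1) ^+ (v \in N) : C).

Definition switch x : {ffun V -> C} := [ffun v => sgn v * x v].

Lemma switchK : involutive switch.
Proof. by move=> x; apply/ffunP => v; rewrite !ffunE signrMK. Qed.

Lemma rank_even : ~~ odd (rank G).
Proof. by have [e eG <-] := edge_of_max_card G; exact: edges_even. Qed.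

(** Switching negates the adjacency tensor: the surplus copies of the pointed
vertex are even in number, so only the signs over the edge itself remain. *)
Lemma prod_sign_adjacent (t : (rank G).-tuple V) :
  adjacency_tensor C G t != 0 -> \prod_(v <- t) sgn v = -1.
Proof.
case/adjacency_tensor_neq0P => e [j [eG je tj]].
rewrite (perm_big _ tj) prod_edge_word // prod_sign.
rewrite -[X in _ * X]signr_odd (N_odd eG) -exprM -[X in X * _]signr_odd oddM.
rewrite oddB ?card_edge_le_rank // (negPf rank_even) (negPf (edges_even eG)).
by rewrite andbF mul1r.
Qed.

Lemma apply_adjacency_switch x i :
  tensor_apply (adjacency_tensor C G) (switch x) i =
    - (sgn i * tensor_apply (adjacency_tensor C G) x i).
Proof.
rewrite !ffunE mulr_sumr -sumrN; apply: eq_bigr => t /eqP hd.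
have [->|t_neq0] := eqVneq (adjacency_tensor C G t) 0.
  by rewrite !mul0r mulr0 oppr0.
have prod_tail : \prod_(v <- behead t) sgn v = - sgn i.
  have := prod_sign_adjacent t_neq0.
  case: t hd {t_neq0} => -[|a r] //= _ [->]; rewrite big_cons => prodE.
  by rewrite -[LHS](signrMK (i \in N)) prodE mulrN1.
rewrite (eq_bigr (fun v => sgn v * x v)) => [|v _]; last by rewrite ffunE.
by rewrite big_split /= prod_tail mulNr mulrN mulrCA.
Qed.

Lemma sign_exp_pred_rank v : sgn v ^+ (rank G).-1 = sgn v.
Proof.
have k_odd : odd (rank G).-1.
  have := rank_even; have := rank_gt0 G.
  by case: (rank G) => //= n _ /negbNE.
by rewrite -exprM -[LHS]signr_odd oddM k_odd andbT oddb.
Qed.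

Lemma apply_degree_switch x i :
  tensor_apply (degree_tensor C G) (switch x) i =
    sgn i * tensor_apply (degree_tensor C G) x i.
Proof.
rewrite !apply_degree_tensor ffunE exprMn mulrCA.
by rewrite sign_exp_pred_rank.
Qed.

Lemma apply_signless_switch x i :
  tensor_apply (signless_laplacian_tensor C G) (switch x) i =
    sgn i * tensor_apply (laplacian_tensor C G) x i.
Proof.
rewrite !tensor_applyD tensor_applyN ffunE apply_degree_switch.
rewrite apply_adjacency_switch [in RHS]ffunE.
by rewrite [in X in _ = _ * (_ + X)]ffunE mulrBr.
Qed.

Lemma apply_laplacian_switch x i :
  tensor_apply (laplacian_tensor C G) (switch x) i =
    sgn i * tensor_apply (signless_laplacian_tensor C G) x i.
Proof. by rewrite -[in RHS](switchK x) apply_signless_switch signrMK. Qed.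

Lemma eigenpair_switch (A B : tensor C V (rank G)) lambda x :
  (forall i, tensor_apply B (switch x) i = sgn i * tensor_apply A x i) ->
  eigenpair A lambda x -> eigenpair B lambda (switch x).
Proof.
move=> AB [x_neq0 Ax]; split.
  apply: contraNneq x_neq0 => x0; rewrite -(switchK x) x0.
  by apply/eqP/ffunP => v; rewrite !ffunE mulr0.
apply/ffunP => i; rewrite AB Ax !ffunE exprMn mulrCA.
by rewrite sign_exp_pred_rank.
Qed.

Lemma eigenpair_laplacian_switch lambda x :
  eigenpair (laplacian_tensor C G) lambda x ->
  eigenpair (signless_laplacian_tensor C G) lambda (switch x).
Proof. by apply: eigenpair_switch => i; rewrite apply_signless_switch. Qed.

Lemma eigenpair_signless_switch lambda x :
  eigenpair (signless_laplacian_tensor C G) lambda x ->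
  eigenpair (laplacian_tensor C G) lambda (switch x).
Proof. by apply: eigenpair_switch => i; rewrite apply_laplacian_switch. Qed.

Lemma switch_real x :
  (forall v, x v \is Num.real) -> forall v, switch x v \is Num.real.
Proof. by move=> xR v; rewrite ffunE rpredM // rpredX // rpredN1. Qed.

Lemma spectra_eq_switch :
  spectrum (laplacian_tensor C G) = spectrum (signless_laplacian_tensor C G) /\
  H_spectrum (laplacian_tensor C G) = H_spectrum (signless_laplacian_tensor C G).
Proof.
split; apply/seteqP; split => lambda.
- by case=> x /eigenpair_laplacian_switch; exists (switch x).
- by case=> x /eigenpair_signless_switch; exists (switch x).
- case=> lR [x [xR /eigenpair_laplacian_switch]].
  by split=> //; exists (switch x); split=> //; exact: switch_real.
- case=> lR [x [xR /eigenpair_signless_switch]].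
  by split=> //; exists (switch x); split=> //; exact: switch_real.
Qed.

End Switching.

Lemma spectra_eq_of_odd_bipartite (C : numClosedFieldType) (V : finType)
    (G : hypergraph V) : odd_bipartite G ->
  spectrum (laplacian_tensor C G) = spectrum (signless_laplacian_tensor C G) /\
  H_spectrum (laplacian_tensor C G) = H_spectrum (signless_laplacian_tensor C G).
Proof.
case=> V1 [V2 [V12T V12_0 V12_odd]].
apply: (@spectra_eq_switch _ _ _ V1) => e eG; first by case: (V12_odd e eG).
have V2E : V2 = ~: V1.
  apply/setP => v; move/setP/(_ v): V12T; move/setP/(_ v): V12_0.
  by rewrite !inE; case: (v \in V1); case: (v \in V2).
have [e1 e2] := V12_odd e eG.
by rewrite -(cardsID V1 e) finset.setDE -V2E oddD e1 e2.
Qed.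

(** * Kernel vectors *)

Lemma connected_propagate (V : finType) (G : hypergraph V) (P : V -> Prop)
    (u v : V) :
  connected_hypergraph G ->
  (forall (e : {set V}) a b, e \in edges G -> a \in e -> b \in e -> P a -> P b) ->
  P u -> P v.
Proof.
move=> /(_ u v)[l [w [e [_ _ <- <- we]]]] P_edge Pu.
suff Pw n (n_le : (n < l.+1)%N) : P (w (Ordinal n_le)).
  by have := Pw l (ltnSn l); congr (P (w _)); apply: val_inj.
elim: n n_le => [|n IHn] n_le.
  by move: Pu; congr (P (w _)); apply: val_inj.
have [eG we1 we2] := we (Ordinal (n_le : (n < l)%N)).
have -> : Ordinal n_le = lift ord0 (Ordinal (n_le : (n < l)%N)) by apply: val_inj.
apply: P_edge eG we1 we2 _.
have -> : widen_ord (leqnSn l) (Ordinal (n_le : (n < l)%N)) = Ordinal (ltnW n_le).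
  exact: val_inj.
exact: IHn.
Qed.

Section SignlessKernel.
Variables (C : numClosedFieldType) (V : finType) (G : hypergraph V).
Implicit Types (x : {ffun V -> C}) (e : {set V}).
Local Notation k := (rank G).
Local Notation gap e := (rank G - #|e|)%N.

(** The all-ones vector is a kernel vector, as row sums equal degrees. *)
Lemma H_eigenvalue_laplacian0 : H_eigenvalue (laplacian_tensor C G) 0.
Proof.
split=> //; exists [ffun=> 1]; split=> [v|]; first by rewrite ffunE.
have [e eG _] := edge_of_max_card G.
have [v _] : exists v, v \in e by apply/card_gt0P; exact: card_edge_gt0 eG.
split; first by apply/eqP => /ffunP/(_ v); rewrite !ffunE; apply/eqP/oner_neq0.
apply/ffunP => i; rewrite tensor_applyD tensor_applyN ffunE apply_degree_tensor.
rewrite !ffunE expr1n mulr1 mul0r -adjacency_tensor_row_sum.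
apply/eqP; rewrite subr_eq0; apply/eqP/eq_bigr => t _.
by rewrite big1 ?mulr1 // => w _; rewrite ffunE.
Qed.

(** Equality case of the triangle inequality at a coordinate of largest modulus:
writing the degree as the row sum of adjacency entries makes the equation a
vanishing sum of nonnegative terms. Only the term of the edge pointed at [i] is
kept, since it carries all that is needed about [e]. *)
Lemma signless_kernel_at_max x i e :
    (forall v, x v \is Num.real) -> (forall v, `|x v| <= `|x i|) ->
    tensor_apply (signless_laplacian_tensor C G) x i = 0 ->
    e \in edges G -> i \in e ->
  x i ^+ gap e * \prod_(v in e) x v = - x i ^+ k.
Proof.
move=> xR x_le Qx0 eG ie.
have [xi0|xi_neq0] := eqVneq (x i) 0.
  by rewrite (bigD1 i ie) /= xi0 mul0r mulr0 expr0n gtn_eqF ?rank_gt0 ?oppr0.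
pose c := x i ^+ k.-1; pose P (t : k.-tuple V) := \prod_(v <- behead t) x v.
have c_neq0 : c != 0 by rewrite expf_neq0.
have cR : c \is Num.real by rewrite rpredX.
have normP t : `|P t| <= `|c|.
  rewrite /P normr_prod normrX (le_trans (ler_prod _ (E2 := fun=> `|x i|) _)) //.
    by move=> v _; rewrite normr_ge0 x_le.
  by rewrite big_const_seq count_predT iter_mulr_1 size_behead size_tuple.
(* Multiplying by [c] makes the terms nonnegative whatever the sign of [c]. *)
have term_ge0 (t : k.-tuple V) : ohead t == Some i ->
    0 <= adjacency_tensor C G t * (c * c + c * P t).
  move=> _; rewrite mulr_ge0 ?adjacency_tensor_ge0 //.
  have PR : P t \is Num.real by apply: rpred_prod => v _.
  have cc_ge0 : 0 <= c * c by rewrite -expr2 real_exprn_even_ge0.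
  have: `|c * P t| <= c * c.
    by rewrite normrM -(ger0_norm cc_ge0) normrM ler_wpM2l.
  rewrite real_ler_norml ?rpredM // => /andP[cP _].
  by rewrite addrC -[c * c]opprK subr_ge0.
have term_sum0 : \sum_(t : k.-tuple V | ohead t == Some i)
    adjacency_tensor C G t * (c * c + c * P t) = 0.
  move: Qx0; rewrite tensor_applyD ffunE apply_degree_tensor ffunE.
  rewrite -adjacency_tensor_row_sum => /(congr1 ( *%R c)).
  rewrite mulr0 mulrDr -/c mulr_suml !mulr_sumr -big_split /= => {2}<-.
  apply: eq_bigr => t _; rewrite mulrDr !mulrA [c * _]mulrC mulrAC.
  by congr (_ + _); rewrite mulrAC.
have sz : size (edge_word (gap e) e i) == k.
  by rewrite size_edge_word // subnK // card_edge_le_rank.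
have := psumr_eq0P term_ge0 term_sum0 (i := Tuple sz).
rewrite /= eqxx => /(_ isT)/eqP.
rewrite mulf_eq0 gt_eqF ?(adjacency_tensor_gt0 C eG ie) //=.
rewrite -mulrDr mulf_eq0 (negPf c_neq0) addrC addr_eq0 => /eqP Pc.
rewrite -prod_edge_word // big_cons -[X in _ * X]/(P (Tuple sz)) Pc mulrN.
by rewrite -exprS prednK // rank_gt0.
Qed.

Lemma signless_kernel_norm_edge x i e v :
    (forall v, x v \is Num.real) -> (forall v, `|x v| <= `|x i|) ->
    tensor_apply (signless_laplacian_tensor C G) x i = 0 ->
    e \in edges G -> i \in e -> v \in e ->
  `|x v| = `|x i|.
Proof.
move=> xR x_le Qx0 eG ie ve; apply/eqP; rewrite eq_le x_le /=.
rewrite real_leNgt ?normr_real //; apply/negP => x_lt.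
have xi_gt0 : 0 < `|x i| by apply: le_lt_trans x_lt.
have /(congr1 Num.norm) := signless_kernel_at_max xR x_le Qx0 eG ie.
rewrite normrM normrN !normrX normr_prod.
rewrite -[in RHS](subnK (card_edge_le_rank eG)) exprD.
move/(mulfI (expf_neq0 _ (lt0r_neq0 xi_gt0))).
rewrite (bigD1 v ve) (cardsD1 v e) ve exprS /= => prodE.
have: `|x v| * \prod_(w in e | w != v) `|x w| < `|x i| * `|x i| ^+ #|e :\ v|.
  apply: (le_lt_trans (y := `|x v| * `|x i| ^+ #|e :\ v|)).
    rewrite ler_wpM2l // -prodr_const.
    rewrite (eq_bigl (fun w => w \in e :\ v)) => [|w]; last first.
      by rewrite !inE andbC.
    by apply: ler_prod => w _; rewrite normr_ge0 x_le.
  by rewrite ltr_pM2r // exprn_gt0.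
by rewrite prodE ltxx.
Qed.

Lemma odd_bipartite_of_signless_kernel :
  connected_hypergraph G -> H_eigenvalue (signless_laplacian_tensor C G) 0 ->
  odd_bipartite G.
Proof.
move=> G_conn [_ [x [xR [x_neq0 Qx]]]].
have {}Qx i : tensor_apply (signless_laplacian_tensor C G) x i = 0.
  by rewrite Qx !ffunE mul0r.
have [i0 xi0] : exists i, x i != 0.
  apply/existsP; apply: contraNT x_neq0 => /existsPn x0.
  by apply/eqP/ffunP => v; rewrite ffunE; apply/eqP/negbNE/x0.
have [i _ x_max] := real_arg_maxP (P := predT) (i0 := i0)
  (F := fun v => `|x v|) isT (fun v _ => normr_real (x v)).
have {}x_max v : `|x v| <= `|x i| by exact: x_max.
have xi_neq0 : `|x i| != 0.
  by rewrite gt_eqF // (lt_le_trans _ (x_max i0)) // normr_gt0.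
have x_norm v : `|x v| = `|x i|.
  apply: (connected_propagate (u := i) (P := fun v => `|x v| = `|x i|)) => //.
  move=> e a b eG ae be xa; rewrite -xa.
  by apply: signless_kernel_norm_edge eG ae be => // w; rewrite xa x_max.
pose N := [set v | x v < 0]%SET.
have xE v : x v = (-1) ^+ (v \in N) * `|x i|.
  by rewrite inE -(x_norm v) -realEsign.
(* All moduli being equal, the edge equation at [v] compares signs only. *)
have parity e v : e \in edges G -> v \in e ->
    odd #|e :&: N| = ~~ ((v \in N) && odd #|e|).
  move=> eG ve.
  have x_le w : `|x w| <= `|x v| by rewrite !x_norm.
  have := signless_kernel_at_max xR x_le (Qx v) eG ve.
  have xv_neq0 : x v != 0 by rewrite -normr_eq0 x_norm.
  rewrite -[in RHS](subnK (card_edge_le_rank eG)) exprD -mulrN.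
  move/(mulfI (expf_neq0 _ xv_neq0)).
  under eq_bigr do rewrite xE.
  rewrite big_split /= prod_sign prodr_const (xE v) exprMn -exprM -mulNr.
  move/(mulIf (expf_neq0 _ xi_neq0)).
  rewrite -[LHS]signr_odd -[X in _ = - X]signr_odd -signrN oddM oddb.
  exact: signr_inj.
(* On an edge of odd size, [parity] would put every vertex on the same side of
[N], which contradicts [parity] itself. *)
have edge_even e : e \in edges G -> ~~ odd #|e|.
  move=> eG; apply/negP => e_odd.
  have eN v : v \in e -> (v \in N) = ~~ odd #|e :&: N|.
    by move=> ve; rewrite (parity _ _ eG ve) e_odd andbT negbK.
  have [eN_odd|eN_even] := boolP (odd #|e :&: N|).
    suff eN0 : e :&: N = finset.set0 by rewrite eN0 cards0 in eN_odd.
    apply/setP => v; rewrite !inE; apply/andP => -[ve].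
    by have := eN v ve; rewrite eN_odd inE => ->.
  suff eNe : e :&: N = e by rewrite eNe e_odd in eN_even.
  by apply/finset.setIidPl/fintype.subsetP => v ve; rewrite eN.
have eN_odd e : e \in edges G -> odd #|e :&: N|.
  move=> eG; have /card_gt0P[v ve] := card_edge_gt0 eG.
  by rewrite (parity _ _ eG ve) (negPf (edge_even _ eG)) andbF.
exists N, (~: N); split; [exact: finset.setUCr|exact: finset.setICr|move=> e eG].
split; first exact: eN_odd.
have := edge_even e eG; rewrite -(cardsID N e) finset.setDE oddD eN_odd //.
by case: (odd _).
Qed.

End SignlessKernel.

Theorem theorem3p8 (R : realType) (V : finType) (G : hypergraph V)
    (G_connected : connected_hypergraph G) :
  let L : tensor R[i] V (rank G) := laplacian_tensor R[i] G in
  let Q : tensor R[i] V (rank G) := signless_laplacian_tensor R[i] G in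
  [<-> odd_bipartite G;
       spectrum L = spectrum Q /\ H_spectrum L = H_spectrum Q;
       H_eigenvalue Q 0].
Proof.
move=> L Q; tfae.
- exact: spectra_eq_of_odd_bipartite.
- case=> _ H_eq; have : H_spectrum L 0 by exact: H_eigenvalue_laplacian0.
  by rewrite H_eq.
- exact: odd_bipartite_of_signless_kernel.
Qed.
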